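(* Let $(u,v)$ be a regular system of parameters of $R$, let $\{\delta_i\}_{i>0}\subset R$ be a sequence of units with residue $1$, and let $\{T_i\}_{i\ge0}$ be the sequence of jumping polynomials in $R$ corresponding to $(u,v)$ and $\{\delta_i\}_{i>0}$ (as defined in the context). Then $\{T_i\}_{i\ge 0}$ is a generating sequence of $\nu$ in $R$.
   Context: Setting: $\mathbf{k}$ is an algebraically closed field of characteristic $\mathbf{p}>0$, $K$ is an algebraic function field of transcendence degree $2$ over $\mathbf{k}$, and $\nu$ is a $\mathbf{k}$-valuation of $K$ with valuation ring $V$ and value group $\Gamma$. It is assumed that $\Gamma$ is a subgroup of $\mathbb{Q}$ and that $V/m_V$ has transcendence degree $0$ over $\mathbf{k}$ (so $V/m_V=\mathbf{k}$). $R$ is a two-dimensional regular local ring, essentially of finite type over $\mathbf{k}$, with quotient field $K$, dominated by $V$ ($R\subset V$, $m_V\cap R=m_R$). Generating sequences: let $\Phi=\nu(R\setminus\{0\})$ and $I_\gamma=\{f\in R\mid\nu(f)\ge\gamma\}$ for $\gamma\in\Phi$. A possibly infinite sequence $\{Q_i\}\subset R$ is a generating sequence of $\nu$ in $R$ if for every $\gamma\in\Phi$ the ideal $I_\gamma$ is generated by $\{\prod_iQ_i^{a_i}\mid a_i\in\mathbb{N}_0,\ \sum_ia_i\nu(Q_i)\ge\gamma\}$ (finite products). Jumping polynomials: let $(u,v)$ be a regular system of parameters of $R$ and let $\{\delta_i\}_{i>0}\subset R$ be units whose residue is $1$ (i.e. $\delta_i-1\in m_R$). Normalize $\Gamma$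 so that $\nu(u)=1$. Set $T_0=u$, $T_1=v$, $q_0=\infty$, and let $(p_1,q_1)$ be the coprime positive integers with $\nu(v)=p_1/q_1$. Recursively, for $i\ge1$, let $$T_{i+1}=T_i^{q_i}-\lambda_i\delta_i\prod_{j=0}^{i-1}T_j^{n_{i,j}},$$ where $n_{i,j}<q_j$ are the (uniquely determined) nonnegative integers with $q_i\nu(T_i)=\nu(\prod_{j=0}^{i-1}T_j^{n_{i,j}})$, and $\lambda_i\in\mathbf{k}\setminus\{0\}$ is the residue of $T_i^{q_i}(\prod_{j=0}^{i-1}T_j^{n_{i,j}})^{-1}$; then $\nu(T_{i+1})>q_i\nu(T_i)$ and $p_{i+1},q_{i+1}$ are the coprime positive integers with $\nu(T_{i+1})=q_i\nu(T_i)+\frac{1}{q_1\cdots q_i}\cdot\frac{p_{i+1}}{q_{i+1}}$. *)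

(* Defs.v *)
From HB Require Import structures.
From mathcomp Require Import all_boot all_order all_algebra.
From mathcomp Require Import mpoly.
Set Implicit Arguments.
Unset Strict Implicit.
Unset Printing Implicit Defensive.
Import Order.TTheory GRing.Theory Num.Theory.
Local Open Scope ring_scope.

(* Ideals are boolean predicates and, as in the library, [idealr_closed]
   means *proper* ideal.  Under classical logic every subset is the extent of
   a boolean predicate, so the quantifications over {pred R} below range over
   all (proper, prime, maximal) ideals. *)

Section CommutativeAlgebra.
Variable R : comNzRingType.

Definition ideal_gen (S : R -> Prop) (f : R) : Prop :=
  exists (n : nat) (c s : 'I_n -> R),
    (forall i, S (s i)) /\ f = \sum_(i < n) c i * s i.

Definition ideal_generated_by (I : {pred R}) (s : seq R) : Prop :=
  forall f, f \in I <-> ideal_gen (fun x => x \in s) f.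

(* The improper ideal, not covered by [idealr_closed], is generated by 1. *)
Definition noetherian : Prop :=
  forall I : {pred R}, idealr_closed I -> exists s, ideal_generated_by I s.

Definition prime_ideal (I : {pred R}) : Prop :=
  idealr_closed I /\ prime_idealr_closed I.

Definition maximal_ideal (m : {pred R}) : Prop :=
  idealr_closed m /\
  forall I : {pred R}, idealr_closed I -> {subset m <= I} -> I =i m.

Definition local_ring (m : {pred R}) : Prop :=
  maximal_ideal m /\ forall m' : {pred R}, maximal_ideal m' -> m' =i m.

Definition prime_chain (d : nat) (P : nat -> {pred R}) : Prop :=
  (forall i, (i <= d)%N -> prime_ideal (P i)) /\
  (forall i, (i < d)%N ->
     {subset P i <= P i.+1} /\ (exists2 x, x \in P i.+1 & x \notin P i)).

Definition krull_dim (d : nat) : Prop :=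
  (exists P, prime_chain d P) /\ ~ (exists P, prime_chain d.+1 P).

Definition regular_local_ring (m : {pred R}) (d : nat) : Prop :=
  [/\ noetherian, local_ring m, krull_dim d
    & exists s : d.-tuple R, ideal_generated_by m s].

End CommutativeAlgebra.

Section Localization.
Variables (A : comNzRingType) (R : comUnitRingType).

(* h : A -> R exhibits R as the localization of A at S. *)
Definition localization_map (S : A -> Prop) (h : A -> R) : Prop :=
  [/\ S 1 /\ (forall s t, S s -> S t -> S (s * t)),
      forall s, S s -> h s \is a GRing.unit,
      forall r, exists a s, S s /\ r = h a / h s
    & forall a b, h a = h b -> exists2 s, S s & s * a = s * b].

End Localization.

Section Algebras.
Variable k : fieldType.

Definition finitely_generated_algebra (A : comNzRingType) (phi : k -> A) :=
  exists (n : nat) (x : 'I_n -> A),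
    forall a, exists P : {mpoly k[n]}, a = mmap phi x P.

Definition essentially_of_finite_type (R : comUnitRingType) (iota : k -> R) :=
  exists (A : comNzRingType) (phi : {rmorphism k -> A})
         (h : {rmorphism A -> R}) (S : A -> Prop),
    [/\ finitely_generated_algebra phi,
        forall c, h (phi c) = iota c
      & localization_map S h].

Variables (K : fieldType) (iota : k -> K).

(* y belongs to the subfield k(x_1, ..., x_n) of K. *)
Definition in_adjoin (n : nat) (x : 'I_n -> K) (y : K) : Prop :=
  exists a b : {mpoly k[n]},
    mmap iota x b != 0 /\ y = mmap iota x a / mmap iota x b.

Definition algebraically_independent (n : nat) (x : 'I_n -> K) : Prop :=
  forall P : {mpoly k[n]}, mmap iota x P = 0 -> P = 0.

Definition algebraic_over (F : K -> Prop) (y : K) : Prop :=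
  exists P : {poly K}, [/\ P != 0, forall i, F P`_i & root P y].

Definition transcendence_degree (d : nat) : Prop :=
  exists x : 'I_d -> K,
    algebraically_independent x /\ forall y, algebraic_over (in_adjoin x) y.

Definition algebraic_function_field (d : nat) : Prop :=
  (exists (n : nat) (x : 'I_n -> K), forall y, in_adjoin x y)
  /\ transcendence_degree d.

End Algebras.

Definition is_fraction_field (R : idomainType) (K : fieldType) (j : R -> K) :=
  injective j /\ forall x, exists a b, b != 0 /\ x = j a / j b.

Section Valuations.
Variables (k K : fieldType) (iota : k -> K) (nu : K -> rat).

(* A k-valuation of K with value group contained in rat.  The value at 0 is
   +oo by convention, so nu is only meaningful on nonzero elements: its value
   at 0 is arbitrary and every definition below treats 0 separately. *)
Definition valuation_over : Prop :=
  [/\ forall x y, x != 0 -> y != 0 -> nu (x * y) = nu x + nu y,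
      forall x y, x != 0 -> y != 0 -> x + y != 0 ->
        Num.min (nu x) (nu y) <= nu (x + y)
    & forall c, c != 0 -> nu (iota c) = 0].

Definition in_valuation_ring (x : K) : Prop := x = 0 \/ 0 <= nu x.

Definition in_valuation_ideal (x : K) : Prop := x = 0 \/ 0 < nu x.

(* nu x = r, for a finite r. *)
Definition has_value (x : K) (r : rat) : Prop := x != 0 /\ nu x = r.

(* The residue of x in V/m_V is the constant c. *)
Definition has_residue (x : K) (c : k) : Prop :=
  in_valuation_ideal (x - iota c).

(* V/m_V is algebraic over k: each residue class is a root of a nonzero
   polynomial over k. *)
Definition residue_field_trdeg0 : Prop :=
  forall x, in_valuation_ring x ->
    exists P : {poly k},
      P != 0 /\ in_valuation_ideal (map_poly iota P).[x].

End Valuations.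

Section ValuationsOnSubring.
Variables (R : idomainType) (K : fieldType) (j : R -> K) (nu : K -> rat).

(* R is identified with the subring j(R) of K. *)
Definition dominated (m : {pred R}) : Prop :=
  (forall r, in_valuation_ring nu (j r)) /\
  (forall r, r \in m <-> in_valuation_ideal nu (j r)).

Definition value_semigroup (gamma : rat) : Prop :=
  exists f : R, f != 0 /\ nu (j f) = gamma.

Definition valuation_ideal (gamma : rat) (f : R) : Prop :=
  f = 0 \/ gamma <= nu (j f).

(* If some Q_i with a_i > 0 vanishes, the monomial is 0, so the arbitrary
   value of nu at 0 does not affect the ideal generated by these monomials. *)
Definition monomial_of_value_ge (Q : nat -> R) (gamma : rat) (f : R) : Prop :=
  exists (N : nat) (a : nat -> nat),
    f = \prod_(i < N) Q i ^+ a i /\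
    gamma <= \sum_(i < N) (a i)%:R * nu (j (Q i)).

Definition generating_sequence (Q : nat -> R) : Prop :=
  forall gamma, value_semigroup gamma ->
    forall f, valuation_ideal gamma f <->
              ideal_gen (monomial_of_value_ge Q gamma) f.

End ValuationsOnSubring.

Section JumpingPolynomials.
Variables (k : fieldType) (R : idomainType) (K : fieldType).
Variables (iota : k -> R) (j : R -> K) (nu : K -> rat).
Variables (u v : R) (delta : nat -> R).

(* The auxiliary data p_i, q_i, n_{i,l}, lambda_i (i > 0) is determined by u,
   v, delta and nu, so at most one sequence T satisfies this.  As q_0 = oo,
   there is no bound on n_{i,0}. *)
Definition jumping_polynomials (T : nat -> R) : Prop :=
  exists (p q : nat -> nat) (n : nat -> nat -> nat) (lambda : nat -> k),
    let M i := \prod_(l < i) T l ^+ n i l in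
    [/\ T 0%N = u /\ T 1%N = v,
        forall i, (0 < i)%N -> [/\ (0 < p i)%N, (0 < q i)%N & coprime (p i) (q i)],
        has_value nu (j (T 1%N)) ((p 1%N)%:R / (q 1%N)%:R)
      & forall i, (0 < i)%N ->
        [/\ forall l, (0 < l < i)%N -> (n i l < q l)%N,
            (q i)%:R * nu (j (T i)) = nu (j (M i)),
            lambda i != 0 /\
            has_residue (j \o iota) nu (j (T i) ^+ q i / j (M i)) (lambda i),
            T i.+1 = T i ^+ q i - iota (lambda i) * delta i * M i
          & has_value nu (j (T i.+1))
              ((q i)%:R * nu (j (T i)) +
               (\prod_(1 <= l < i.+1) (q l)%:R)^-1 *
               ((p i.+1)%:R / (q i.+1)%:R))]].

End JumpingPolynomials.

(* Main.v *)
(** Let [Jge alpha] and [Jgt alpha] be the ideals generated by the monomials in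
    the [T i] of value [>= alpha] and [> alpha].  Since the residue field is
    [k], and since [T i ^+ q i] is a scalar multiple of a monomial in
    [T 0, .., T i.-1] modulo higher value, every element of [Jge alpha] is
    modulo [Jgt alpha] a [k]-combination of standard monomials
    ([a i < q i] for [i > 0]) of value [alpha].  As [p i] and [q i] are coprime,
    there is at most one such monomial, so an [f] in [Jge alpha] with
    [nu f > alpha] lies in [Jgt alpha].  Finally [nu (T i)] is unbounded, so
    the values of monomials below [gamma] have a common denominator [D], and
    any [f] with [nu f >= gamma] climbs from [Jge 0] to [Jge gamma] in
    steps of [1 / D]. *)

Require Import Defs.
From mathcomp Require Import all_boot all_order all_algebra.
From mathcomp Require Import ring.
Set Implicit Arguments.
Unset Strict Implicit.
Unset Printing Implicit Defensive.
Import Order.TTheory GRing.Theory Num.Theory.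
Local Open Scope ring_scope.

(** * Ideals generated by a set *)

Section IdealGen.
Variable R : comNzRingType.
Implicit Types (S : R -> Prop) (f g r x : R).

Lemma ideal_gen_ind S (P : R -> Prop) :
  P 0 -> (forall f g, P f -> P g -> P (f + g)) ->
  (forall r x, S x -> P (r * x)) -> forall f, ideal_gen S f -> P f.
Proof.
move=> P0 PD PM f [n [c [s [Ss ->]]]].
by apply: (big_ind P) => // i _; apply: PM.
Qed.

Lemma ideal_gen0 S : ideal_gen S 0.
Proof.
by exists 0%N, (fun=> 0), (fun=> 0); split; [case | rewrite big_ord0].
Qed.

Lemma ideal_genM S r x : S x -> ideal_gen S (r * x).
Proof.
by move=> Sx; exists 1%N, (fun=> r), (fun=> x); split; last by rewrite big_ord1.
Qed.

Lemma ideal_gen_mem S x : S x -> ideal_gen S x.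
Proof. by rewrite -[x in ideal_gen _ x]mul1r; apply: ideal_genM. Qed.

Lemma ideal_genD S f g : ideal_gen S f -> ideal_gen S g -> ideal_gen S (f + g).
Proof.
move=> [n [c [s [Ss ->]]]] [n' [c' [s' [Ss' ->]]]].
exists (n + n')%N.
exists (fun i => match split i with inl l => c l | inr l => c' l end).
exists (fun i => match split i with inl l => s l | inr l => s' l end).
split; first by move=> i; case: (split i).
rewrite big_split_ord /=; congr (_ + _); apply: eq_bigr => i _.
  by rewrite (unsplitK (inl i : _ + _)).
by rewrite (unsplitK (inr i : _ + _)).
Qed.

(** Common source of the transport rules below: [x = 1] gives inclusion of ideals, [S' = S] gives
    closure under multiples, and a monomial [x] shifts the weight filtration in [JgtM]. *)
Lemma ideal_gen_mulr S S' x : (forall s, S s -> ideal_gen S' (s * x)) ->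
  forall f, ideal_gen S f -> ideal_gen S' (f * x).
Proof.
move=> SS'; apply: ideal_gen_ind => [|f g Jf Jg|r s Ss].
- by rewrite mul0r; apply: ideal_gen0.
- by rewrite mulrDl; apply: ideal_genD.
rewrite -mulrA; have [n [c [t [S't ->]]]] := SS' _ Ss.
by exists n, (fun i => r * c i), t; split=> //; rewrite mulr_sumr;
  apply: eq_bigr => i _; rewrite mulrA.
Qed.

Lemma ideal_gen_sub S S' : (forall s, S s -> ideal_gen S' s) ->
  forall f, ideal_gen S f -> ideal_gen S' f.
Proof.
move=> SS' f Jf; rewrite -[f]mulr1.
by apply: ideal_gen_mulr Jf => s Ss; rewrite mulr1; apply: SS'.
Qed.

Lemma ideal_genMl S r f : ideal_gen S f -> ideal_gen S (r * f).
Proof.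
move=> Jf; rewrite mulrC; apply: ideal_gen_mulr Jf => s Ss.
by rewrite mulrC; apply: ideal_genM.
Qed.

End IdealGen.

(** * Weighted monomials and the filtrations [Jge], [Jgt] *)

Section WeightedMonomials.
Variables (R : comNzRingType) (T : nat -> R) (w : nat -> rat).
Implicit Types (N : nat) (a b : nat -> nat) (alpha beta : rat) (x y : R).

Definition monom N a : R := \prod_(i < N) T i ^+ a i.
Definition weight N a : rat := \sum_(i < N) (a i)%:R * w i.
(** Pads exponents by zero, so that monomials in different numbers of variables can be compared at a
    common length. *)
Definition truncate N a i : nat := if (i < N)%N then a i else 0%N.

(** The weight belongs to an expression as a monomial: before a valuation enters, one ring element
    may have several weights. *)
Definition has_weight alpha x : Prop :=
  exists N a, x = monom N a /\ alpha = weight N a.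

Definition Jge alpha : R -> Prop :=
  ideal_gen (fun x => exists2 beta, alpha <= beta & has_weight beta x).
Definition Jgt alpha : R -> Prop :=
  ideal_gen (fun x => exists2 beta, alpha < beta & has_weight beta x).

Lemma monom_truncate N N' a :
  (N <= N')%N -> monom N' (truncate N a) = monom N a.
Proof.
move=> leNN'; rewrite /monom (big_ord_widen _ (fun i => T i ^+ a i) leNN').
rewrite [RHS]big_mkcond /=; apply: eq_bigr => i _.
by rewrite /truncate; case: ifP.
Qed.

Lemma weight_truncate N N' a :
  (N <= N')%N -> weight N' (truncate N a) = weight N a.
Proof.
move=> leNN'; rewrite /weight (big_ord_widen _ (fun i => (a i)%:R * w i) leNN').
rewrite [RHS]big_mkcond /=; apply: eq_bigr => i _.
by rewrite /truncate; case: ifP; rewrite ?mul0r.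
Qed.

Lemma eq_monom N a b : (forall i, (i < N)%N -> a i = b i) ->
  monom N a = monom N b.
Proof. by move=> ab; rewrite /monom; apply: eq_bigr => i _; rewrite ab. Qed.

Lemma eq_weight N a b : (forall i, (i < N)%N -> a i = b i) ->
  weight N a = weight N b.
Proof. by move=> ab; rewrite /weight; apply: eq_bigr => i _; rewrite ab. Qed.

Lemma monomD N a b :
  monom N (fun i => (a i + b i)%N) = monom N a * monom N b.
Proof. by rewrite /monom -big_split; apply: eq_bigr => i _; rewrite exprD. Qed.

Lemma weightD N a b :
  weight N (fun i => (a i + b i)%N) = weight N a + weight N b.
Proof.
by rewrite /weight -big_split; apply: eq_bigr => i _; rewrite natrD mulrDl.
Qed.

Lemma monomMn N e a : monom N (fun i => (e * a i)%N) = monom N a ^+ e.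
Proof.
by rewrite /monom -prodrXl; apply: eq_bigr => i _; rewrite mulnC exprM.
Qed.

Lemma weightMn N e a : weight N (fun i => (e * a i)%N) = e%:R * weight N a.
Proof.
by rewrite /weight mulr_sumr; apply: eq_bigr => i _; rewrite natrM mulrA.
Qed.

Lemma monomS N a : monom N.+1 a = monom N a * T N ^+ a N.
Proof. exact: big_ord_recr. Qed.

Lemma weightS N a : weight N.+1 a = weight N a + (a N)%:R * w N.
Proof. exact: big_ord_recr. Qed.

Lemma has_weight_monom N a : has_weight (weight N a) (monom N a).
Proof. by exists N, a. Qed.

Lemma has_weight1 : has_weight 0 1.
Proof. by exists 0%N, (fun=> 0%N); rewrite /monom /weight !big_ord0. Qed.

Lemma has_weightM alpha beta x y :
  has_weight alpha x -> has_weight beta y -> has_weight (alpha + beta) (x * y).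
Proof.
move=> [N [a [-> ->]]] [N' [b [-> ->]]].
exists (maxn N N'), (fun i => (truncate N a i + truncate N' b i)%N).
rewrite monomD weightD !monom_truncate ?weight_truncate //;
  by rewrite ?leq_maxl ?leq_maxr.
Qed.

Lemma has_weightX alpha x e :
  has_weight alpha x -> has_weight (e%:R * alpha) (x ^+ e).
Proof.
by move=> [N [a [-> ->]]]; exists N, (fun i => (e * a i)%N);
  rewrite monomMn weightMn.
Qed.

Lemma has_weight_gen i : has_weight (w i) (T i).
Proof.
exists i.+1, (fun l => (l == i) : nat); rewrite monomS weightS eqxx mul1r.
have lt_ne l : (l < i)%N -> ((l == i) : nat) = 0%N by move/ltn_eqF->.
rewrite (eq_monom lt_ne) (eq_weight lt_ne) /monom /weight.
by rewrite !big1 ?mul1r ?add0r // => l _; rewrite mul0r.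
Qed.

Lemma Jgt_has_weight alpha beta x :
  alpha < beta -> has_weight beta x -> Jgt alpha x.
Proof. by move=> ab wx; apply: ideal_gen_mem; exists beta. Qed.

Lemma JgtM alpha beta x f :
  has_weight beta x -> Jgt alpha f -> Jgt (alpha + beta) (f * x).
Proof.
move=> wx; apply: ideal_gen_mulr => s [c ac ws].
by apply: Jgt_has_weight (has_weightM ws wx); rewrite ltrD2r.
Qed.

End WeightedMonomials.

(** * Arithmetic of the values of the jumping polynomials *)

Lemma modn_mulr_coprime p q a b :
  coprime p q -> (a * p = b * p %[mod q])%N -> a = b %[mod q].
Proof.
wlog le_ba : a b / (b <= a)%N => [hw co eq_ab|co].
  have [le_ba|/ltnW le_ab] := leqP b a; first exact: hw.
  by apply/esym/hw.
move=> /eqP; rewrite eqn_mod_dvd ?leq_mul2r ?le_ba ?orbT // -mulnBl.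
by rewrite Gauss_dvdl 1?coprime_sym // => dvd_q; apply/eqP; rewrite eqn_mod_dvd.
Qed.

Section JumpingWeights.
Variables (w : nat -> rat) (p q : nat -> nat).
Hypothesis pq : forall i, (0 < i)%N ->
  [/\ (0 < p i)%N, (0 < q i)%N & coprime (p i) (q i)].
(** A common denominator of [w 0], ..., [w i]. The product starts at 1, in accordance with [q_0]
    being infinite. *)
Let d i : nat := (\prod_(1 <= l < i.+1) q l)%N.
Hypotheses (w0 : w 0%N = 1) (w1 : w 1%N = (p 1%N)%:R / (q 1%N)%:R).
Hypothesis wS : forall i, (0 < i)%N ->
  w i.+1 = (q i)%:R * w i + (d i)%:R^-1 * ((p i.+1)%:R / (q i.+1)%:R).

Let p_gt0 i : (0 < p i.+1)%N. Proof. by case: (pq (ltn0Sn i)). Qed.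
Let q_gt0 i : (0 < q i.+1)%N. Proof. by case: (pq (ltn0Sn i)). Qed.

Let d0 : d 0 = 1%N. Proof. by rewrite /d big_nil. Qed.

Let dS i : d i.+1 = (d i * q i.+1)%N.
Proof. by rewrite /d big_nat_recr. Qed.

Let d_gt0 i : (0 < d i)%N.
Proof. by elim: i => [|i IH]; rewrite ?d0 // dS muln_gt0 IH q_gt0. Qed.

Let dR_gt0 i : 0 < (d i)%:R :> rat. Proof. by rewrite ltr0n. Qed.
Let dR_neq0 i : (d i)%:R != 0 :> rat. Proof. exact: lt0r_neq0. Qed.

Let wS_d i : (0 < i)%N -> w i.+1 = (q i)%:R * w i + (p i.+1)%:R / (d i.+1)%:R.
Proof.
move=> i_gt0; rewrite wS // dS natrM; congr (_ + _).
by rewrite invfM mulrCA mulrA.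
Qed.

(** The shape of the numerator matters: it is [p i.+1] modulo [q i.+1], so coprimality can later
    recover exponents from weights. In the induction, passing to the denominator [d i.+2] turns the
    old part into a multiple of [q i.+2]. *)
Lemma jump_weight_frac i :
  exists x, w i.+1 = (q i.+1 * x + p i.+1)%:R / (d i.+1)%:R.
Proof.
elim: i => [|i [x IH]].
  by exists 0%N; rewrite muln0 w1 dS d0 mul1n.
exists (q i.+1 * (q i.+1 * x + p i.+1))%N.
rewrite wS_d // IH [d i.+2]dS !natrD !natrM.
have := dR_neq0 i.+1; have : (q i.+2)%:R != 0 :> rat.
  by rewrite pnatr_eq0 -lt0n q_gt0.
by move=> q0 D0; field; rewrite q0 D0.
Qed.

(** Each step adds a term [p / d >= 1 / d] with the new denominator [d], and the earlier bound
    survives because [q >= 1] and [d] does not decrease. *)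
Lemma jump_weight_ge i : i.+1%:R / (d i.+1)%:R <= w i.+1.
Proof.
elim: i => [|i IH].
  rewrite w1 dS d0 mul1n ler_pM2r ?invr_gt0 ?ltr0n ?q_gt0 //.
  by rewrite ler_nat p_gt0.
rewrite wS_d // -[i.+2%:R]natr1 mulrDl lerD //; last first.
  by rewrite ler_pM2r ?invr_gt0 // ler1n p_gt0.
apply: le_trans (_ : (i.+1)%:R / (d i.+1)%:R <= _).
  rewrite ler_wpM2l // lef_pV2 ?posrE // ler_nat [d i.+2]dS leq_pmulr // q_gt0.
rewrite (le_trans IH) // ler_peMl ?ler1n ?q_gt0 //.
by apply: le_trans IH; rewrite divr_ge0.
Qed.

Lemma jump_weight_gt0 i : 0 < w i.
Proof.
case: i => [|i]; first by rewrite w0.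
by apply: lt_le_trans (jump_weight_ge i); rewrite divr_gt0 ?ltr0n.
Qed.

Lemma jump_weight_lt i : (0 < i)%N -> (q i)%:R * w i < w i.+1.
Proof. by move=> i_gt0; rewrite wS_d // ltrDl divr_gt0 ?ltr0n. Qed.

Lemma jump_weight_ge_d i : (d i)%:R * w 1%N <= w i.+1.
Proof.
elim: i => [|i IH]; first by rewrite d0 mul1r.
apply: le_trans (ltW (jump_weight_lt (ltn0Sn i))).
by rewrite dS natrM mulrAC mulrC ler_wpM2l.
Qed.

(* [w i >= i / d i] and [w i.+1 >= d i * w 1] combine to
   [w i.+1 ^+ 2 >= i * w 1], whether or not [d] is bounded. *)
Lemma jump_weight_unbounded gamma :
  exists L, forall i, (L <= i)%N -> gamma <= w i.
Proof.
have w1_gt0 := jump_weight_gt0 1.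
have sqr_ge i : i.+1%:R * w 1%N <= w i.+2 ^+ 2.
  have ge1 := jump_weight_ge i; have ge2 := jump_weight_ge_d i.+1.
  have le12 : w i.+1 <= w i.+2.
    apply: le_trans (ltW (jump_weight_lt (ltn0Sn i))).
    by rewrite ler_peMl ?ler1n ?q_gt0 // ltW // jump_weight_gt0.
  have -> : i.+1%:R * w 1%N = (i.+1%:R / (d i.+1)%:R) * ((d i.+1)%:R * w 1%N).
    by field; rewrite dR_neq0.
  rewrite expr2 ler_pM ?divr_ge0 ?mulr_ge0 ?ler0n ?(ltW w1_gt0) //.
  exact: le_trans ge1 le12.
(* [B.+1] exceeds [gamma ^+ 2 / w 1]; the threshold [B.+2] matches the index shift in [sqr_ge]. *)
pose B := Num.truncn (gamma ^+ 2 / w 1%N).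
exists B.+2 => -[|[|i]] // ltBi.
rewrite leNgt; apply/negP => lt_gamma.
have : w i.+2 ^+ 2 < gamma ^+ 2.
  by rewrite ltrXn2r ?nnegrE // ltW ?jump_weight_gt0 //
     (lt_trans _ lt_gamma) ?jump_weight_gt0.
apply/negP; rewrite -leNgt; apply: le_trans (sqr_ge i).
rewrite -ler_pdivrMr // (le_trans (ltW (truncnS_gt _))) //.
by rewrite ler_nat.
Qed.

Lemma jump_weight_nat i l : (i <= l)%N -> (d l)%:R * w i \is a Num.nat.
Proof.
move=> le_il.
have [x ->] : exists x, w i = x%:R / (d i)%:R.
  case: i {le_il} => [|i]; first by exists 1%N; rewrite w0 d0 divr1.
  by have [x ->] := jump_weight_frac i; eexists.
have [y ->] : exists y, d l = (d i * y)%N.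
  elim: l le_il => [|l IH].
    by rewrite leqn0 => /eqP->; exists 1%N; rewrite muln1.
  rewrite leq_eqVlt => /predU1P[<-|/IH[y dl]].
    by exists 1%N; rewrite muln1.
  by exists (y * q l.+1)%N; rewrite dS dl mulnA.
have -> : (d i * y)%:R * (x%:R / (d i)%:R) = (y * x)%:R :> rat.
  by rewrite !natrM; field; rewrite dR_neq0.
exact: natr_nat.
Qed.

(** With [N.+1] variables the last one is [T N], so [d N] already clears all denominators. *)
Lemma weight_nat N a : (d N)%:R * weight w N.+1 a \is a Num.nat.
Proof.
rewrite mulr_sumr rpred_sum // => i _.
by rewrite mulrCA rpredM ?natr_nat // jump_weight_nat // -ltnS.
Qed.

(** Index 0 is left free because [q_0] is infinite. *)
Definition standard N a := forall i, (0 < i < N)%N -> (a i < q i)%N.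

(** Exponents are recovered from the top down. After multiplication by [d N.+1], the lower variables
    contribute multiples of [q N.+1], while the top one contributes its exponent times [p N.+1]
    modulo [q N.+1]. Coprimality fixes that exponent modulo [q N.+1], and standardness fixes it
    exactly. *)
Lemma standard_weight_inj N a b : standard N a -> standard N b ->
  weight w N a = weight w N b -> forall i, (i < N)%N -> a i = b i.
Proof.
elim: N => // -[|N] IH sa sb;
  rewrite [weight w _ a]weightS [weight w _ b]weightS.
  rewrite /weight !big_ord0 !add0r w0 !mulr1 => /eqP.
  by rewrite eqr_nat => /eqP ab [].
move=> eq_ab.
have ab : a N.+1 = b N.+1.
  have [x wN] := jump_weight_frac N.
  have /natrP[A dA] := weight_nat N a; have /natrP[B dB] := weight_nat N b.
  have : (d N.+1)%:R * (weight w N.+1 a + (a N.+1)%:R * w N.+1) =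
         (d N.+1)%:R * (weight w N.+1 b + (b N.+1)%:R * w N.+1).
    by rewrite eq_ab.
  have key c C : (d N)%:R * weight w N.+1 c = C%:R ->
    (d N.+1)%:R * (weight w N.+1 c + (c N.+1)%:R * w N.+1) =
      (q N.+1 * C + c N.+1 * (q N.+1 * x + p N.+1))%:R.
    move=> dC; rewrite mulrDr [in LHS]dS [in LHS]natrM mulrAC dC wN.
    by rewrite [in RHS]natrD !natrM [(q _)%:R * C%:R]mulrC; congr (_ + _);
      rewrite -natrM -dS mulrCA; congr (_ * _); rewrite mulrC divfK.
  rewrite (key a A) // (key b B) // => /eqP; rewrite eqr_nat => /eqP eqAB.
  have [_ _ co] := pq (ltn0Sn N).
  have split_mod c C : (q N.+1 * C + c * (q N.+1 * x + p N.+1) =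
    (C + c * x) * q N.+1 + c * p N.+1)%N.
    by rewrite [(c * (_ + _))%N]mulnDr addnA mulnCA -mulnDr [(q _ * _)%N]mulnC.
  have := congr1 (modn^~ (q N.+1)) eqAB; rewrite /= !split_mod !modnMDl.
  by move/(modn_mulr_coprime co); rewrite !modn_small ?sa ?sb ?ltnSn.
move=> i; rewrite ltnS leq_eqVlt => /predU1P[-> //|].
apply: IH; first by move=> l /andP[l0 lN]; apply: sa; rewrite l0 ltnW.
  by move=> l /andP[l0 lN]; apply: sb; rewrite l0 ltnW.
by move: eq_ab; rewrite ab => /addIr.
Qed.

(** A monomial of weight below [gamma] cannot involve any [T i] with [w i >= gamma], so only the
    indices below some [L] occur, and [d L] clears their denominators. *)
Lemma weight_discrete gamma : exists2 D, (0 < D)%N &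
  forall N a, weight w N a < gamma -> D%:R * weight w N a \is a Num.nat.
Proof.
have [L ge_gamma] := jump_weight_unbounded gamma.
exists (d L) => // N a lt_gamma; rewrite mulr_sumr rpred_sum // => i _.
have [lt_iL|/ge_gamma le_gamma] := ltnP i L.
  by rewrite mulrCA rpredM ?natr_nat // jump_weight_nat // ltnW.
suff -> : a i = 0%N by rewrite mul0r mulr0 rpred0.
have term_ge0 l : 0 <= (a l)%:R * w l.
  by rewrite mulr_ge0 // ltW ?jump_weight_gt0.
have : (a i)%:R * w i < w i.
  apply: le_lt_trans (lt_le_trans lt_gamma le_gamma).
  by rewrite /weight (bigD1 i) //= lerDl sumr_ge0.
by rewrite gtr_pMl ?jump_weight_gt0 // ltrn1 ltnS leqn0 => /eqP.
Qed.

End JumpingWeights.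

(** * The valuation on [R] and its residue field *)

Section ValuationOnSubring.
Variables (k K : fieldType) (R : idomainType).
Variables (iota : {rmorphism k -> R}) (j : {rmorphism R -> K}) (nu : K -> rat).
Hypothesis nu_valuation : valuation_over (j \o iota) nu.
Hypothesis j_inj : injective j.
Hypothesis nu_ge0 : forall r, in_valuation_ring nu (j r).
Implicit Types (f g r : R) (alpha : rat).

Let j_neq0 f : (j f != 0) = (f != 0).
Proof. by rewrite raddf_eq0. Qed.

Let nuM x y : x != 0 -> y != 0 -> nu (x * y) = nu x + nu y.
Proof. by case: nu_valuation => + _ _; apply. Qed.

Lemma valuation1 : nu 1 = 0.
Proof.
have := nuM (oner_neq0 K) (oner_neq0 K); rewrite mulr1 => /esym/eqP.
by rewrite -subr_eq0 addrK => /eqP.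
Qed.

Lemma valuationX x e : x != 0 -> nu (x ^+ e) = e%:R * nu x.
Proof.
move=> x0; elim: e => [|e IH]; first by rewrite expr0 mul0r valuation1.
by rewrite exprS nuM ?expf_neq0 // IH mulrSr mulrDl mul1r addrC.
Qed.

(** [B] is an arbitrary upper set of values, so that the bounds [alpha <= _] and [alpha < _] are
    treated together. *)
Lemma valuation_ideal_gen (B : rat -> bool) (S : R -> Prop) :
  (forall b c, b <= c -> B b -> B c) ->
  (forall s, S s -> s = 0 \/ B (nu (j s))) ->
  forall f, ideal_gen S f -> f = 0 \/ B (nu (j f)).
Proof.
move=> Bup SB; apply: ideal_gen_ind => [|f g Bf Bg|r s /SB Bs]; first by left.
  have [f0|f0] := eqVneq f 0; first by rewrite f0 add0r.
  have [g0|g0] := eqVneq g 0; first by rewrite g0 addr0.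
  have [fg0|fg0] := eqVneq (f + g) 0; first by left.
  case: Bf Bg => [/eqP|Bf]; [by rewrite (negPf f0) | case=> [/eqP|Bg]].
    by rewrite (negPf g0).
  right; case: nu_valuation => _ nuD _.
  have := nuD (j f) (j g); rewrite -rmorphD !j_neq0 => /(_ f0 g0 fg0).
  by rewrite minElt; case: ifP => _ /Bup; apply.
have [r0|r0] := eqVneq r 0; first by left; rewrite r0 mul0r.
case: Bs => [->|Bs]; first by left; rewrite mulr0.
have [s0|s0] := eqVneq s 0; first by left; rewrite s0 mulr0.
right; apply: Bup Bs; rewrite rmorphM nuM ?j_neq0 // lerDr.
by case: (nu_ge0 r) => // /eqP; rewrite (negPf (_ : j r != 0)) ?j_neq0.
Qed.

Variable T : nat -> R.
Hypothesis T_neq0 : forall i, T i != 0.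
Let w i := nu (j (T i)).

Lemma valuation_has_weight alpha x :
  has_weight T w alpha x -> x != 0 /\ nu (j x) = alpha.
Proof.
move=> [N [a [-> ->]]]; elim: N => [|N [IH0 IH]].
  by rewrite /monom /weight !big_ord0 oner_neq0 rmorph1 valuation1.
rewrite monomS weightS mulf_neq0 ?expf_neq0 //.
by rewrite rmorphM rmorphXn nuM ?valuationX ?expf_neq0 ?j_neq0 ?IH.
Qed.

Lemma valuation_Jge alpha f : Jge T w alpha f -> valuation_ideal j nu alpha f.
Proof.
apply: (@valuation_ideal_gen (fun b => alpha <= b)) => [b c bc /le_trans|s].
  exact.
by move=> [b ab /valuation_has_weight[_ ->]]; right.
Qed.

Lemma valuation_Jgt alpha f :
  Jgt T w alpha f -> f = 0 \/ alpha < nu (j f).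
Proof.
apply: (@valuation_ideal_gen (fun b => alpha < b)) => [b c bc /lt_le_trans|s].
  exact.
by move=> [b ab /valuation_has_weight[_ ->]]; right.
Qed.

(** If [c] were nonzero, [iota c * x] would have value exactly [alpha], yet it is the difference of
    [f] and [f - iota c * x], which both lie strictly above [alpha]. *)
Lemma Jgt_leading_term alpha c x f : has_weight T w alpha x ->
  Jgt T w alpha (f - iota c * x) -> f = 0 \/ alpha < nu (j f) -> c = 0.
Proof.
move=> wx Jfx Vf; apply/eqP/negPn/negP => c0.
have [x0 nux] := valuation_has_weight wx.
pose S g := g = 0 \/ alpha < nu (j g).
have : S (iota c * x).
  (* The set [S] is taken as its own generating set: this expresses that it is closed under
     differences. *)
  apply: (@valuation_ideal_gen (fun b => alpha < b) S) =>
    // [b d bd /lt_le_trans|].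
    exact.
  rewrite -[iota c * x]mul1r -[1 * _](subKr f) mul1r -[- _]mulN1r.
  apply: ideal_genD; first exact: ideal_gen_mem.
  by apply: ideal_genM; apply: valuation_Jgt.
have ic0 : iota c != 0 by rewrite fmorph_eq0.
case=> [/eqP|]; first by rewrite mulf_eq0 (negPf ic0) (negPf x0).
rewrite rmorphM nuM ?j_neq0 // nux; case: nu_valuation => _ _ nuC.
by have /= -> := nuC _ c0; rewrite add0r ltxx.
Qed.

End ValuationOnSubring.

(** A polynomial killing the residue of [x] splits over [k]. If no factor [x - h c] were zero or of
    positive value, the product would be nonzero of value at most 0. *)
Lemma residue_exists (k : closedFieldType) (K : fieldType)
    (h : {rmorphism k -> K}) (nu : K -> rat) :
  valuation_over h nu -> residue_field_trdeg0 h nu ->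
  forall x, in_valuation_ring nu x ->
    exists c, in_valuation_ideal nu (x - h c).
Proof.
move=> nu_val res x /res[P [P0 Px]].
have [rs defP] := closed_field_poly_normal P.
have lead0 : lead_coef P != 0 by rewrite lead_coef_eq0.
have [nuM _ nuC] := nu_val.
have hC c : c != 0 -> h c != 0 by rewrite fmorph_eq0.
have [/hasP[c _ cx]|/hasPn nocx] :=
    boolP (has (fun c => (x - h c == 0) || (0 < nu (x - h c))) rs).
  by exists c; case/orP: cx => [/eqP|]; [left|right].
pose y := h (lead_coef P) * \prod_(c <- rs) (x - h c).
have Py : (map_poly h P).[x] = y.
  rewrite [in LHS]defP map_polyZ rmorph_prod /= hornerZ horner_prod.
  by congr (_ * _); apply: eq_bigr => c _; rewrite map_polyXsubC hornerXsubC.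
have [y0 nuy] : y != 0 /\ nu y <= 0.
  rewrite {Py}/y; elim: rs nocx {defP} => [|c rs IH] nocx.
    by rewrite big_nil mulr1 hC // nuC.
  have [y0 nuy] := IH (fun d rd => nocx d (mem_behead (s := c :: rs) rd)).
  have /norP[xc0 xc1] := nocx c (mem_head _ _).
  rewrite big_cons mulrCA mulf_neq0 // nuM //; split=> //.
  by rewrite -[0]addr0 lerD // leNgt.
by case: Px => [/eqP|]; rewrite Py; [rewrite (negPf y0)|rewrite ltNge nuy].
Qed.

(** * Reduction to standard monomials *)

Section Reduction.
Variables (k : fieldType) (R : idomainType) (iota : {rmorphism k -> R}).
Variables (T delta : nat -> R) (w : nat -> rat).
Variables (q : nat -> nat) (n : nat -> nat -> nat) (lambda : nat -> k).
Hypothesis w_gt0 : forall i, 0 < w i.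
Hypothesis q_gt0 : forall i, (0 < i)%N -> (0 < q i)%N.
(** Stands for the maximal ideal, whose generators [u] and [v] are [T 0] and [T 1]. *)
Let mR : R -> Prop := ideal_gen (fun x => x \in [:: T 0%N; T 1%N]).
Hypothesis residue : forall r, exists c, mR (r - iota c).
Hypothesis delta_residue : forall i, (0 < i)%N -> mR (delta i - 1).
Hypothesis weight_n : forall i, (0 < i)%N -> (q i)%:R * w i = weight w i (n i).
Hypothesis w_lt : forall i, (0 < i)%N -> (q i)%:R * w i < w i.+1.
Hypothesis TS : forall i, (0 < i)%N ->
  T i.+1 = T i ^+ q i - iota (lambda i) * delta i * monom T i (n i).

Lemma Jgt_mR alpha f x :
  mR f -> has_weight T w alpha x -> Jgt T w alpha (f * x).
Proof.
move=> mf wx; apply: ideal_gen_mulr mf => s; rewrite !inE.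
have wTx i : Jgt T w alpha (T i * x).
  by apply: Jgt_has_weight (has_weightM (has_weight_gen T w i) wx);
    rewrite ltrDr.
by case/orP=> /eqP->; apply: wTx.
Qed.

(** The recursion replaces [T i ^+ q i] by a scalar times [monom T i (n i)] up to two errors of
    higher weight: [T i.+1], and a multiple of [delta i - 1], which lies in [mR]. The factor [x] is
    arbitrary so that it can absorb the monomials already substituted. *)
Lemma replace_power alpha x i e : (0 < i)%N -> has_weight T w alpha x ->
  Jgt T w (alpha + e%:R * ((q i)%:R * w i))
    (x * T i ^+ q i ^+ e - iota (lambda i ^+ e) * (x * monom T i (n i) ^+ e)).
Proof.
move=> i_gt0; elim: e alpha x => [|e IH] alpha x wx.
  by rewrite !expr0 rmorph1 mul1r subrr; apply: ideal_gen0.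
have wM : has_weight T w ((q i)%:R * w i) (monom T i (n i)).
  by rewrite weight_n //; apply: has_weight_monom.
have wTe : has_weight T w (e%:R * ((q i)%:R * w i)) (T i ^+ q i ^+ e).
  by do 2!apply: has_weightX; apply: has_weight_gen.
have weightE : alpha + e.+1%:R * ((q i)%:R * w i) =
    (alpha + (q i)%:R * w i) + e%:R * ((q i)%:R * w i).
  by rewrite -natr1; ring.
(* The first summand is the error of one replacement, times the [e] remaining powers; the second is
   the induction hypothesis for [x * monom T i (n i)]. *)
have -> : x * T i ^+ q i ^+ e.+1 -
    iota (lambda i ^+ e.+1) * (x * monom T i (n i) ^+ e.+1) =
  (T i.+1 * x + iota (lambda i) * ((delta i - 1) * (x * monom T i (n i))))
     * T i ^+ q i ^+ e +
  iota (lambda i) * ((x * monom T i (n i)) * T i ^+ q i ^+ e -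
     iota (lambda i ^+ e) * (x * monom T i (n i) * monom T i (n i) ^+ e)).
  by rewrite TS // !exprS rmorphM; ring.
rewrite weightE; apply: ideal_genD; last first.
  by apply: ideal_genMl; apply: IH; apply: has_weightM.
apply: JgtM wTe _; apply: ideal_genD.
  apply: Jgt_has_weight (has_weightM (has_weight_gen T w i.+1) wx).
  by rewrite addrC ltrD2r w_lt.
by apply: ideal_genMl; apply: Jgt_mR; [apply: delta_residue|apply: has_weightM].
Qed.

(** Divide the top exponent by [q N] and trade each full power [T N ^+ q N] for [monom T N (n N)].
    Only exponents of lower index grow, and the induction on [N] reduces those. *)
Lemma reduce_monom N a : exists b c, [/\ standard q N b,
  weight w N b = weight w N a &
  Jgt T w (weight w N a) (monom T N a - iota c * monom T N b)].
Proof.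
elim: N a => [|N IH] a.
  by exists a, 1; split=> // [l|]; rewrite ?ltn0 ?andbF // rmorph1 mul1r subrr;
    apply: ideal_gen0.
(* With [T 0] alone, every exponent is standard. *)
have [N0|N_gt0] := posnP N.
  exists a, 1; split=> [l||]; rewrite ?N0 //; first by case: l.
  by rewrite rmorph1 mul1r subrr; apply: ideal_gen0.
pose e := (a N %/ q N)%N; pose r := (a N %% q N)%N.
have [b [c [sb wb Jb]]] := IH (fun i => (a i + e * n N i)%N).
pose b' i := if i == N then r else b i.
have eq_b i : (i < N)%N -> b' i = b i by rewrite /b' => /ltn_eqF->.
have aN : a N = (q N * e + r)%N by rewrite mulnC -divn_eq.
have wTr : has_weight T w (r%:R * w N) (T N ^+ r).
  by apply/has_weightX/has_weight_gen.
have weight_a : weight w N.+1 a =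
    weight w N a + e%:R * ((q N)%:R * w N) + r%:R * w N.
  by rewrite weightS aN natrD natrM; ring.
exists b', (lambda N ^+ e * c); split.
- move=> l /andP[l0]; rewrite ltnS leq_eqVlt /b' => /predU1P[->|lN].
    by rewrite eqxx ltn_mod q_gt0.
  by rewrite ltn_eqF // sb // l0.
- rewrite weightS (eq_weight w eq_b) wb weightD weightMn -weight_n //.
  by rewrite weight_a /b' eqxx.
rewrite weight_a !monomS (eq_monom T eq_b) /b' eqxx.
have -> : monom T N a * T N ^+ a N -
    iota (lambda N ^+ e * c) * (monom T N b * T N ^+ r) =
  (monom T N a * T N ^+ q N ^+ e -
     iota (lambda N ^+ e) * (monom T N a * monom T N (n N) ^+ e) +
   iota (lambda N ^+ e) * (monom T N a * monom T N (n N) ^+ e -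
     iota c * monom T N b)) * T N ^+ r.
  by rewrite aN exprD exprM rmorphM; ring.
apply: JgtM wTr _; apply: ideal_genD.
  exact: replace_power N_gt0 (has_weight_monom _ _ _ _).
apply: ideal_genMl; move: Jb.
by rewrite monomD monomMn weightD weightMn -weight_n.
Qed.

Definition standard_monomial alpha x :=
  exists N b, [/\ standard q N b, x = monom T N b & alpha = weight w N b].

Hypothesis standard_inj : forall N a b, standard q N a -> standard q N b ->
  weight w N a = weight w N b -> forall i, (i < N)%N -> a i = b i.

Lemma standard_monomial_inj alpha x y :
  standard_monomial alpha x -> standard_monomial alpha y -> x = y.
Proof.
move=> [N [a [sa -> ->]]] [N' [b [sb ->]]].
have [leN leN'] := (leq_maxl N N', leq_maxr N N').
(* Padding by zeros preserves standardness because [q i > 0]. *)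
have st M M' c : standard q M c -> standard q M' (truncate M c).
  move=> sc i /andP[i0 _]; rewrite /truncate.
  by case: ifP => iM; [rewrite sc ?i0 | rewrite q_gt0].
rewrite -(monom_truncate T a leN) -(monom_truncate T b leN').
rewrite -(weight_truncate w a leN) -(weight_truncate w b leN').
by move/standard_inj => eq_ab; apply: eq_monom; apply: eq_ab; apply: st.
Qed.

(** Coefficients become constants modulo [mR], monomials become standard by [reduce_monom], and
    uniqueness of the standard monomial of weight [alpha] lets the constants be added. The case
    [c = 0] covers weights at which no standard monomial exists. *)
Lemma leading_standard_monomial alpha f : Jge T w alpha f ->
  exists c x, (c = 0 \/ standard_monomial alpha x) /\
    Jgt T w alpha (f - iota c * x).
Proof.
move: f; apply: ideal_gen_ind => [|f g [c [x [sx Jx]]] [d [y [sy Jy]]]|r s].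
- by exists 0, 0; split; [left|rewrite mulr0 subr0; apply: ideal_gen0].
- have Jfg : Jgt T w alpha (f + g - (iota c * x + iota d * y)).
    by rewrite opprD addrACA; apply: ideal_genD.
  have [c0|c0] := eqVneq c 0.
    by exists d, y; move: Jfg; rewrite c0 rmorph0 mul0r add0r.
  have [d0|d0] := eqVneq d 0.
    by exists c, x; move: Jfg; rewrite d0 rmorph0 mul0r addr0.
  case: sx => [/eqP|sx]; first by rewrite (negPf c0).
  case: sy => [/eqP|sy]; first by rewrite (negPf d0).
  exists (c + d), x; split; first by right.
  by rewrite rmorphD mulrDl {2}(standard_monomial_inj sx sy).
move=> [beta]; rewrite le_eqVlt => /predU1P[<-{beta}|lt_ab] ws; last first.
  exists 0, 0; split; first by left.
  by rewrite mulr0 subr0; apply: ideal_genM; exists beta.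
have [z rz] := residue r; have mrs := Jgt_mR rz ws.
move: ws mrs => [N [a [-> ->]]] mrs.
have [b [c [sb wb Jb]]] := reduce_monom N a.
exists (z * c), (monom T N b); split; first by right; exists N, b.
have -> : r * monom T N a - iota (z * c) * monom T N b =
  (r - iota z) * monom T N a + iota z * (monom T N a - iota c * monom T N b).
  by rewrite rmorphM; ring.
by apply: ideal_genD => //; apply: ideal_genMl.
Qed.

End Reduction.

(** * Ascent through the discrete weights below [gamma] *)

Lemma Jge_of_Jgt (R : comNzRingType) (T : nat -> R) (w : nat -> rat)
    (gamma : rat) (D m : nat) : (0 < D)%N ->
  (forall N a, weight w N a < gamma -> D%:R * weight w N a \is a Num.nat) ->
  forall f, Jgt T w (m%:R / D%:R) f ->
    Jge T w (Num.min gamma (m.+1%:R / D%:R)) f.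
Proof.
move=> D_gt0 discr; apply: ideal_gen_sub => s [beta lt_beta ws].
(* A multiple of [1 / D] above [m / D] is at least [m.+1 / D]; the minimum with [gamma] absorbs the
   weights outside the range of [discr]. *)
apply: ideal_gen_mem; exists beta => //; rewrite ge_min.
have [//|lt_gamma] := leP gamma beta.
have D0 : 0 < D%:R :> rat by rewrite ltr0n.
case: ws lt_beta lt_gamma => N [a [_ ->]] lt_beta /discr /natrP[b wb].
move: lt_beta; rewrite ler_pdivrMr // ltr_pdivrMr // mulrC wb.
by rewrite ltr_nat ler_nat.
Qed.

Theorem theorem5p4
  (k : closedFieldType) (p : nat) (char_k : p \in [pchar k])
  (K : fieldType) (R : idomainType)
  (iota : {rmorphism k -> R}) (j : {rmorphism R -> K})
  (function_field_K : algebraic_function_field (j \o iota) 2)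
  (nu : K -> rat)
  (nu_valuation : valuation_over (j \o iota) nu)
  (residue_field_nu : residue_field_trdeg0 (j \o iota) nu)
  (m : {pred R})
  (regular_R : regular_local_ring m 2)
  (eft_R : essentially_of_finite_type iota)
  (fraction_field_R : is_fraction_field j)
  (dominated_R : dominated j nu m)
  (u v : R)
  (regular_parameters_uv : ideal_generated_by m [:: u; v])
  (nu_u : has_value nu (j u) 1)
  (delta : nat -> R)
  (delta_unit : forall i, (0 < i)%N -> delta i \is a GRing.unit)
  (delta_residue : forall i, (0 < i)%N -> delta i - 1 \in m)
  (T : nat -> R)
  (T_jumping : jumping_polynomials iota j nu u v delta T) :
  generating_sequence j nu T.

Proof.
have j_inj : injective j by case: fraction_field_R.
have [V_R m_V] := dominated_R.
case: T_jumping => pp [q [n [lambda [[T0 T1] pq [jT1_neq0 w1] step]]]].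
pose w i := nu (j (T i)).
have q_gt0 i : (0 < i)%N -> (0 < q i)%N by case/pq.
have T_neq0 i : T i != 0.
  suff : j (T i) != 0 by apply: contra_neq => ->; rewrite rmorph0.
  case: i => [|[|i]] //; first by rewrite T0; case: nu_u.
  by case: (step i.+1 isT) => _ _ _ _ [].
have w0 : w 0%N = 1 by rewrite /w T0; case: nu_u.
have wS i : (0 < i)%N -> w i.+1 = (q i)%:R * w i +
    (\prod_(1 <= l < i.+1) q l)%N%:R^-1 * ((pp i.+1)%:R / (q i.+1)%:R).
  by move=> i_gt0; rewrite natr_prod; case: (step i i_gt0) => _ _ _ _ [].
have w_gt0 := jump_weight_gt0 pq w0 w1 wS.
have w_lt := jump_weight_lt pq wS.
have has_nu := valuation_has_weight nu_valuation j_inj T_neq0.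
have weight_n i : (0 < i)%N -> (q i)%:R * w i = weight w i (n i).
  move=> i_gt0; case: (step i i_gt0) => _ -> _ _ _.
  by have [] := has_nu _ _ (has_weight_monom T w i (n i)).
have TS i : (0 < i)%N -> T i.+1 =
    T i ^+ q i - iota (lambda i) * delta i * monom T i (n i).
  by move=> i_gt0; case: (step i i_gt0).
have mE f : f \in m -> ideal_gen (fun x => x \in [:: T 0%N; T 1%N]) f.
  by rewrite T0 T1; case: (regular_parameters_uv f).
have residue r : exists c,
    ideal_gen (fun x => x \in [:: T 0%N; T 1%N]) (r - iota c).
  (* Domination turns positive value of [r - iota c] into membership in [m]. *)
  have [c rc] := residue_exists nu_valuation residue_field_nu (V_R r).
  by exists c; apply: mE; apply/m_V; rewrite rmorphB.
have delta_mR i (i_gt0 : (0 < i)%N) := mE _ (delta_residue i i_gt0).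
move=> gamma _ f; split=> [Vf|]; last first.
  move=> Jf; apply: (valuation_Jge nu_valuation j_inj V_R T_neq0).
  apply: ideal_gen_sub Jf => s [N [a [-> ge_gamma]]].
  by apply: ideal_gen_mem; exists (weight w N a) => //; exists N, a.
suff : Jge T w gamma f.
  apply: ideal_gen_sub => s [b ge_gamma [N [a [-> eq_b]]]].
  by apply: ideal_gen_mem; exists N, a; rewrite -[X in _ <= X]eq_b.
have [D D_gt0 discr] := weight_discrete pq w0 w1 wS gamma.
have J_step l : Jge T w (Num.min gamma (l%:R / D%:R)) f.
  elim: l => [|l IH].
    (* The empty monomial 1 has weight 0, so [Jge 0] is all of [R]. *)
    rewrite -[f]mulr1; apply: ideal_genM; exists 0; last exact: has_weight1.
    by rewrite mul0r ge_min lexx orbT.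
  (* Once the level has reached [gamma], the minimum stays there; before that, it is [l / D]. *)
  move: IH; have [le_gamma|lt_gamma Jf] := leP gamma (l%:R / D%:R).
    rewrite min_l // (le_trans le_gamma) // ler_wpM2r ?invr_ge0 ?ler0n //.
    by rewrite ler_nat.
  apply: Jge_of_Jgt => //.
  have [c [x [sx Jx]]] := leading_standard_monomial w_gt0 q_gt0 residue
    delta_mR weight_n w_lt TS (standard_weight_inj pq w0 w1 wS) Jf.
  (* Since [f] is zero or has value at least [gamma > l / D], no term of weight exactly [l / D] can
     lead. *)
  suff c0 : c = 0 by move: Jx; rewrite c0 rmorph0 mul0r subr0.
  case: sx => // -[N [b [_ xE wE]]].
  apply: (Jgt_leading_term nu_valuation j_inj V_R T_neq0) Jx _.
    by rewrite xE wE; apply: has_weight_monom.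
  by case: Vf => [|le_gamma]; [left | right; apply: lt_le_trans le_gamma].
(* This level is at least [gamma * D], so the minimum is [gamma]. *)
have := J_step (Num.bound `|gamma * D%:R|).
rewrite min_l // ler_pdivlMr ?ltr0n //.
exact: le_trans (ler_norm _) (ltW (archi_boundP (normr_ge0 _))).
Qed.
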